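(* For every number $n$ of agents, there exists a cake-division instance with $n$ agents and a market valuation in which every allocation of the cake that is envy-free both with respect to the subjective utilities and with respect to the market valuation has at least $2n-2$ cuts. This lower bound holds even when the agents' utilities are identical (i.e., such an instance exists with all agents having the same subjective density function).
   Context: The cake is the interval $[0,1]$; a piece is a Borel subset of $[0,1]$. A density function is an integrable $f:[0,1]\to\mathbb{R}_{\ge0}$, and the value of a piece $X$ is $f(X)=\int_X f(x)\,dx$. A cake-division instance consists of $n$ agents with subjective density functions $u_1,\dots,u_n$ and a market density function $v$. An allocation $A=(A_1,\dots,A_n)$ is a partition of $[0,1]$ into $n$ pieces, pairwise disjoint up to overlaps of Lebesgue measure zero, with $A_i$ given to agent $i$. $A$ is envy-free (EF) with respect to the subjective utilities if $u_i(A_i)\ge u_i(A_j)$ for all agents $i,j$, and EF with respect to the market valuation if $v(A_i)=v(A_j)$ for all $i,j$. The number of cuts of an allocation is the smallest number of points in $(0,1)$ (cut points) such that, up to sets of measure zero, every piece $A_i$ is a union of some of the intervals into which these points divide $[0,1]$ (infinite if no finite set of points suffices). *)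

(* Defs.v *)
From HB Require Import structures.
From mathcomp Require Import all_boot all_order all_algebra.
From mathcomp Require Import all_classical all_reals all_analysis.

Set Implicit Arguments.
Unset Strict Implicit.
Unset Printing Implicit Defensive.

Import Order.TTheory GRing.Theory Num.Theory.
Import numFieldNormedType.Exports.

Local Open Scope classical_set_scope.
Local Open Scope ring_scope.

Definition is_piece (R : realType) (X : set R) : Prop :=
  measurable X /\ X `<=` `[0, 1]%classic.

(* Densities are total functions on [R]; only their values on [[0, 1]] matter,
   since they are only ever integrated over pieces. *)
Definition is_density (R : realType) (f : R -> R) : Prop :=
  (forall x, x \in `[0, 1] -> 0 <= f x) /\
  (@lebesgue_measure R).-integrable `[0, 1]%classic (EFin \o f).

Definition value (R : realType) (f : R -> R) (X : set R) : \bar R :=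
  (\int[@lebesgue_measure R]_(x in X) (f x)%:E)%E.

Record cake_instance (R : realType) (n : nat) := CakeInstance {
  utility : 'I_n -> R -> R;
  market : R -> R;
  utility_density : forall i, is_density (utility i);
  market_density : is_density market
}.

Definition identical_utilities (R : realType) (n : nat)
    (I : cake_instance R n) : Prop :=
  forall i j : 'I_n, utility I i = utility I j.

Definition is_allocation (R : realType) (n : nat) (A : 'I_n -> set R) : Prop :=
  [/\ forall i, is_piece (A i),
      \bigcup_i A i = `[0, 1]%classic &
      forall i j, i != j -> lebesgue_measure (A i `&` A j) = 0%E].

Definition envy_free (R : realType) (n : nat) (I : cake_instance R n)
    (A : 'I_n -> set R) : Prop :=
  forall i j, (value (utility I i) (A j) <= value (utility I i) (A i))%E.

Definition market_envy_free (R : realType) (n : nat) (I : cake_instance R n)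
    (A : 'I_n -> set R) : Prop :=
  forall i j, value (market I) (A i) = value (market I) (A j).

(* A finite set of points of (0, 1) is given by its strictly increasing
   enumeration. *)
Definition is_cut_seq (R : realType) (s : seq R) : Prop :=
  sorted <%R s /\ {in s, forall x, 0 < x < 1}.

(* The [j]-th of the [(size s).+1] intervals into which [s] divides [[0, 1]];
   the choice of closed intervals is immaterial up to null sets. *)
Definition cut_interval (R : realType) (s : seq R) (j : nat) : set R :=
  let p := 0 :: rcons s 1 in `[p`_j, p`_j.+1]%classic.

Definition cuts_suffice (R : realType) (n : nat) (A : 'I_n -> set R)
    (s : seq R) : Prop :=
  forall i, exists J : {set 'I_(size s).+1},
    lebesgue_measure (A i `+` \bigcup_(j in [set` J]) cut_interval s j) = 0%E.

(* The infimum is over a set of natural numbers, so it is a minimum when the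
   set is nonempty; it is [+oo] when no finite set of cut points suffices. *)
Definition num_cuts (R : realType) (n : nat) (A : 'I_n -> set R) : \bar R :=
  ereal_inf [set ((size s)%:R)%:E |
    s in [set s | is_cut_seq s /\ cuts_suffice A s]].

(* Main.v *)
Require Import Defs.
From HB Require Import structures.
From mathcomp Require Import all_boot all_order all_algebra.
From mathcomp Require Import all_classical all_reals all_analysis.

Import Order.TTheory GRing.Theory Num.Theory.
Import numFieldNormedType.Exports.

Local Open Scope classical_set_scope.
Local Open Scope ring_scope.

(* All agents value only the left half of the cake, uniformly, and the market
   values only the right half, uniformly. Envy-freeness then forces every agent
   to receive a set of positive measure in each half. Assigning to each agent
   an interval of its piece that meets a given half in positive measure is
   injective, so each half is met by at least n intervals and hence contains at
   least n - 1 cuts in its interior. *)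

(* [measurable] on a set of reals and the measurability expected by
   [negligibleP] for [lebesgue_measure] are convertible but have different
   displays, which defeats unification. *)
Lemma lebesgue_negligibleP (R : realType) (X : set R) :
  measurable X -> lebesgue_measure.-negligible X <-> lebesgue_measure X = 0%E.
Proof. by move=> mX; apply: negligibleP; exact: mX. Qed.

Lemma negligible_bigcup_fin d (T : sigmaRingType d) (R : realFieldType)
    (mu : {measure set T -> \bar R}) (I : finType) (P : set I)
    (F : I -> set T) :
  (forall i, P i -> mu.-negligible (F i)) ->
  mu.-negligible (\bigcup_(i in P) F i).
Proof.
(* Putting [set0] at indices outside [P] lets the union run over [enum I], where induction on the
   big union applies. *)
move=> F0; rewrite bigcup_mkcond.
apply: (@negligibleS _ _ _ _
    (\bigcup_(i in [set` enum I]) if i \in P then F i else set0)).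
  apply: bigcup_sub => i _; apply: (@bigcup_sup _ _ i) => //=.
  by rewrite mem_enum.
rewrite bigcup_seq; elim/big_ind: _ => [||i _].
- exact: negligible_set0.
- exact: negligibleU.
- by case: ifPn => [/set_mem/F0//|_]; exact: negligible_set0.
Qed.

Lemma negligible_closed_itv (R : realType) (a b : R) :
  lebesgue_measure.-negligible `[a, b] -> b <= a.
Proof.
move=> ab0; have := lebesgue_measure_itv `[a, b].
rewrite ((lebesgue_negligibleP _ _ _).1 ab0) //= lte_fin.
case: ltP => // ab; rewrite -EFinB => -[/esym/eqP].
by rewrite subr_eq0 gt_eqF.
Qed.

(** If either inequality failed, the two closed intervals would share at most the point [b],
    respectively [a]. *)
Lemma cut_interval_meets (R : realType) (a b : R) (s : seq R) (j : nat) :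
  ~ lebesgue_measure.-negligible (cut_interval s j `&` `[a, b]) ->
  (0 :: rcons s 1)`_j < b /\ a < (0 :: rcons s 1)`_j.+1.
Proof.
have null1 (x : R) : lebesgue_measure.-negligible [set x].
  apply/lebesgue_negligibleP; first exact: measurable_set1.
  exact: lebesgue_measure_set1.
rewrite /cut_interval => ninter; split; rewrite ltNge; apply/negP => le_p;
  apply: ninter;
  [apply: negligibleS (null1 b)|apply: negligibleS (null1 a)] => x /=;
  rewrite !in_itv /= => -[/andP[px xp] /andP[ax xb]]; apply/eqP.
- by rewrite eq_le xb (le_trans le_p).
- by rewrite eq_le ax (le_trans xp).
Qed.

Lemma card_nth_count (T : Type) (x0 : T) (P : pred T) (t : seq T) m :
  size t = m -> #|[set j : 'I_m | P (nth x0 t j)]%SET| = count P t.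
Proof.
move=> <-; rewrite -sum1_card -sum1_count (big_nth x0) big_mkord.
by apply: eq_bigl => i; rewrite inE.
Qed.

Lemma card_cut_intervals (R : realType) (a b : R) (s : seq R) :
  is_cut_seq s -> 0 <= a ->
  (#|[set j : 'I_(size s).+1 |
      ((0 :: rcons s 1)`_j < b)%R && (a < (0 :: rcons s 1)`_j.+1)%R]%SET|
   <= (count (fun x => a < x < b)%R s).+1)%N.
Proof.
move=> [sorted_s s01] a0; set p := 0 :: rcons s 1.
have sorted_p : sorted <%R p.
  rewrite /= rcons_path; apply/andP; split.
    rewrite (path_sortedE lt_trans) sorted_s andbT.
    by apply/allP => x /s01/andP[].
  by have := mem_last 0 s; rewrite inE => /predU1P[->|/s01/andP[]].
pose L := [set j : 'I_(size s).+1 | p`_j <= a < p`_j.+1]%SET.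
pose M := [set j : 'I_(size s).+1 | a < p`_j < b]%SET.
(* Only the interval containing [a] fails to start inside [(a, b)]. *)
have L1 : (#|L| <= 1)%N.
  (* From [p_l < p_(k+1)] sortedness gives [l < k + 1]; used in both directions, this identifies any
     two members of [L]. *)
  have nlt (k l : 'I_(size s).+1) : p`_l <= a -> a < p`_k.+1 -> (l <= k)%N.
    move=> pla /(le_lt_trans pla); rewrite ltNge (lt_sorted_leq_nth 0 sorted_p).
    - by rewrite -ltnNge ltnS.
    - by rewrite inE /= size_rcons ltnS.
    - by rewrite inE /= size_rcons ltnS ltnW.
  apply/card_le1_eqP => k l; rewrite !inE => /andP[pka ak] /andP[pla al].
  by apply/val_inj/eqP; rewrite eqn_leq !nlt.
have <- : #|M| = count (fun x => a < x < b)%R s.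
  (* The left endpoints of the intervals are the entries of [0 :: s], and [0] is not counted because
     [0 <= a]. *)
  transitivity (count (fun x => a < x < b)%R (0 :: s)).
    rewrite -(@card_nth_count _ 0 _ (0 :: s) (size s).+1) //.
    apply: eq_card => k.
    by rewrite !inE /p -rcons_cons nth_rcons /= ltn_ord.
  by rewrite /= ltNge a0.
apply: (@leq_trans #|(L :|: M)%SET|).
  apply/subset_leq_card/fintype.subsetP => k; rewrite !inE => /andP[-> ->].
  by rewrite !andbT leNgt; case: (a < _).
by rewrite (leq_trans (leq_card_setU _ _)) // -(add1n #|M|) leq_add2r.
Qed.

(** If one share of [[a, b]] were null, the comparison would make all shares null, hence also their
    finite union [[a, b]]. *)
Lemma pieces_meet (R : realType) (n : nat) (A : 'I_n -> set R) (a b : R) :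
  is_allocation A -> 0 <= a -> a < b -> b <= 1 ->
  (forall i j, lebesgue_measure (A j `&` `[a, b]) <=
               lebesgue_measure (A i `&` `[a, b]))%E ->
  forall i, ~ lebesgue_measure.-negligible (A i `&` `[a, b]).
Proof.
move=> [pieceA coverA _] a0 ab b1 leA i Ai0.
have mAH j : measurable (A j `&` `[a, b]).
  by apply: measurableI => //; case: (pieceA j).
have : lebesgue_measure.-negligible (\bigcup_j (A j `&` `[a, b])).
  apply: negligible_bigcup_fin => j _; apply/lebesgue_negligibleP => //.
  apply/eqP; rewrite -measure_le0 (le_trans (leA i j)) //.
  by rewrite ((lebesgue_negligibleP _ _ (mAH i)).1 Ai0).
rewrite -setI_bigcupl coverA setIidr; last first.
  by apply: subset_itvScc.
by move/negligible_closed_itv; rewrite leNgt ab.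
Qed.

Lemma cuts_in_subinterval (R : realType) (n : nat) (A : 'I_n -> set R)
    (s : seq R) (a b : R) :
  is_allocation A -> is_cut_seq s -> cuts_suffice A s -> 0 <= a ->
  (forall i, ~ lebesgue_measure.-negligible (A i `&` `[a, b])) ->
  (n <= (count (fun x => a < x < b)%R s).+1)%N.
Proof.
move=> [pieceA _ disjA] cut_s /= /choice[J AJ] a0 meetA.
pose U i := \bigcup_(j in [set` J i]) cut_interval s j.
have mC j : measurable (cut_interval s j) by exact: measurable_itv.
have nullY i : lebesgue_measure.-negligible (A i `+` U i).
  apply/lebesgue_negligibleP; last exact: AJ.
  have mA := (pieceA i).1.
  have mU : measurable (U i) by exact: fin_bigcup_measurable.
  by apply: measurableU; exact: measurableD.
(* Otherwise [A i] within [[a, b]] would be covered by the null set where it differs from [U i] and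
   finitely many null intersections. *)
have /choice[g gP] i : exists j, j \in J i /\
    ~ lebesgue_measure.-negligible (cut_interval s j `&` `[a, b]).
  apply: contrapT => nex; apply: (meetA i).
  have null_cuts : lebesgue_measure.-negligible
      (\bigcup_(j in [set` J i]) (cut_interval s j `&` `[a, b])).
    apply: negligible_bigcup_fin => j Jj.
    by apply: contrapT => nj; apply: nex; exists j.
  apply: negligibleS (negligibleU (nullY i) null_cuts) => x [Aix abx].
  have [[j Jj xj]|nUx] := pselect (U i x); first by right; exists j.
  by left; left.
(* An interval chosen by two agents lies in [U i] and [U i'], so up to null sets in the null overlap
   of their pieces; yet it meets [[a, b]] in a non-null set. *)
have g_inj : injective g.
  move=> i i' gii'; apply: contrapT => /eqP nii'.
  have [Jg []] := gP i; have [Jg' _] := gP i'; rewrite -gii' in Jg'.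
  have nullI : lebesgue_measure.-negligible (A i `&` A i').
    apply/lebesgue_negligibleP; last exact: disjA.
    by apply: measurableI; [case: (pieceA i)|case: (pieceA i')].
  apply: negligibleS (negligibleU nullI (negligibleU (nullY i) (nullY i'))).
  move=> x [xg _].
  have Ux : U i x by exists (g i).
  have Ux' : U i' x by exists (g i).
  have [Aix|nAix] := pselect (A i x); last by right; left; right.
  have [Aix'|nAix'] := pselect (A i' x); last by right; right; right.
  by left.
apply: leq_trans (card_cut_intervals _ a b _ cut_s a0).
rewrite -[X in (X <= _)%N]card_ord -(card_imset _ g_inj).
apply/subset_leq_card/fintype.subsetP => _ /imsetP[i _ ->]; rewrite inE.
by have [_ /cut_interval_meets[-> ->]] := gP i.
Qed.

Lemma indic_itv_density (R : realType) (a b : R) : is_density \1_(`[a, b]).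
Proof.
split => [x _|]; first by rewrite indicE ler0n.
exact: integrableS (integrable_indic_itv a b true false).
Qed.

Lemma value_indic (R : realType) (H X : set R) :
  measurable H -> measurable X ->
  value \1_H X = lebesgue_measure (X `&` H).
Proof. by move=> mH mX; rewrite /value integral_indic // setIC. Qed.

Definition halves_instance (R : realType) (n : nat) : cake_instance R n :=
  @CakeInstance R n (fun=> \1_(`[0, 2^-1])) (\1_(`[2^-1, 1]))
    (fun=> indic_itv_density _ _ _) (indic_itv_density _ _ _).

Lemma halves_instance_num_cuts (R : realType) (n : nat) (A : 'I_n -> set R) :
  is_allocation A -> envy_free (halves_instance R n) A ->
  market_envy_free (halves_instance R n) A ->
  (((2 * n - 2)%N%:R)%:E <= num_cuts A)%E.
Proof.
(* It suffices to bound [size s] for each admissible [s]; this also covers the infimum [+oo] of the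
   empty set. *)
move=> allocA efA mefA; apply: le_ereal_inf_tmp => _ [s [cut_s sufs] <-].
have mA i : measurable (A i) by case: allocA => /(_ i)[].
have half0 : 0 < 2^-1 :> R by rewrite invr_gt0.
have half1 : 2^-1 < 1 :> R by rewrite invf_lt1 // ltr1n.
have L : (n <= (count (fun x => 0 < x < 2^-1)%R s).+1)%N.
  apply: (cuts_in_subinterval _ _ _ _ _ _ allocA cut_s sufs (lexx 0)).
  apply: (pieces_meet _ _ _ _ _ allocA (lexx 0) half0 (ltW half1)) => i j.
  by have := efA i j; rewrite !value_indic.
have U : (n <= (count (fun x => 2^-1 < x < 1)%R s).+1)%N.
  apply: (cuts_in_subinterval _ _ _ _ _ _ allocA cut_s sufs (ltW half0)).
  apply: (pieces_meet _ _ _ _ _ allocA (ltW half0) half1 (lexx 1)) => i j.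
  by have := mefA i j; rewrite !value_indic // => ->.
(* The open halves are disjoint, so no cut is counted twice; a cut at [2^-1] is counted in
   neither. *)
have LU : (count (fun x => 0 < x < 2^-1)%R s +
           count (fun x => 2^-1 < x < 1)%R s <= size s)%N.
  rewrite -count_predUI [X in (_ + X)%N](eq_count (a2 := pred0)).
    by rewrite count_pred0 addn0 count_size.
  move=> x /=; apply/negbTE/negP => /andP[/andP[_ xh] /andP[hx _]].
  by have := lt_trans xh hx; rewrite ltxx.
(* Moving the truncated subtraction across leaves [n + n <= 2 + size s], the sum of the bounds for
   the two halves. *)
rewrite lee_fin ler_nat leq_subLR mulnC muln2 -addnn.
apply: leq_trans (leq_add L U) _.
by rewrite addSn addnS add2n !ltnS.
Qed.

Theorem theorem10 (R : realType) (n : nat) :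
  (exists I : cake_instance R n,
     forall A : 'I_n -> set R,
       is_allocation A -> envy_free I A -> market_envy_free I A ->
       (((2 * n - 2)%N%:R)%:E <= num_cuts A)%E) /\
  (exists I : cake_instance R n,
     identical_utilities I /\
     forall A : 'I_n -> set R,
       is_allocation A -> envy_free I A -> market_envy_free I A ->
       (((2 * n - 2)%N%:R)%:E <= num_cuts A)%E).
Proof.
(* One instance serves both claims, since its utility does not depend on the agent. *)
by split; exists (halves_instance R n); [|split => //];
  exact: halves_instance_num_cuts.
Qed.
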